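(* Let $\mathbb F=(f_1,\dots,f_k)$ be a tuple of integers and let $L_{p,q}$ be the lens space obtained by surgery on $S^3$ along the framed generalised Hopf link $(\mathbb H_k,\mathbb F)$. Let $\sigma$ be the signature of $(\mathbb H_k,\mathbb F)$. Then $$tr_{\varepsilon}(L_{p,q})=\frac{(1+\varepsilon^2\beta_{\varepsilon}^2)^{\sigma}}{(\varepsilon+2)^{\frac{\sigma+k+1}{2}}}\cdot\left(1+\sum_{s=1}^{k}\left(\varepsilon^{s}\cdot\sum_{\{i_1,\dots,i_s\}}\frac{c(i_1,\dots,i_s)}{\beta_{\varepsilon}^{2f_{i_1}+\dots+2f_{i_s}}}\right)\right),$$ where the inner sum is over all subsets $\{i_1,\dots,i_s\}\subseteq\{1,\dots,k\}$ with $s$ elements.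
   Context: Function $c$: for natural numbers $i_1<\dots<i_s$, split the sequence into maximal runs of consecutive integers, with lengths $l_1,\dots,l_r$ (an isolated element is a run of length $1$). Then $c(i_1,\dots,i_s)=\prod_{j=1}^r\frac{(-1)^{l_j-1}}{\varepsilon^{l_j-2}}$. Generalised Hopf link: $\mathbb H_k$ has a diagram consisting of $k$ trivial circles $U_1,\dots,U_k$ such that for each $i\in\{1,\dots,k-1\}$ the pair $U_i,U_{i+1}$ is linked as in the two-crossing diagram of the Hopf link, with no other crossings. Surgery on $S^3$ along $(\mathbb H_k,\mathbb F)$ gives the lens space $L_{p,q}$ with $\frac pq=f_1-\frac1{f_2-\frac1{\dots-\frac1{f_k}}}$. Category $\mathfrak E$. Let $I=\{\mathbf 1,\mathbf A\}$. Objects are finite ordered tuples of elements of $I$, written as noncommutative sums $x_1+\dots+x_n$. A morphism $f:\sum_i x_i\to\sum_j y_j$ is a family $a_i^j\in\mathbb C$ with $a_i^j=0$ if $x_i\ne y_j$; equivalently a pair of matrices $[f]_{\mathbf 1},[f]_{\mathbf A}$ (columns: summands of the source equal to the given symbol, rows: those of the target, in order). Composition is written left to right, $[f\circ g]_S=[g]_S[f]_S$; identities have identity matrices. Tensor product: $\mathbf 1\otimes\mathbf 1=\mathbf 1$, $\mathbf 1\otimes\mathbf A=\mathbf A\otimes\mathbf 1=\mathbf A$, $\mathbf A\otimes\mathbf A=\mathbf 1+\mathbf A$, and $(\sum_i x_i)\otimes(\sum_j y_j)=\sum_i\sum_j x_i\otimes y_j$ in lexicographic order; for $f=(f_i^j)$,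 $g=(g_r^s)$, the entry of $f\otimes g$ from a summand of $x_i\otimes z_r$ to a summand of $y_j\otimes t_s$ is $f_i^jg_r^s$ if $x_i=y_j$, $z_r=t_s$ and the two summands are the same summand of $x_i\otimes z_r=y_j\otimes t_s$, and $0$ otherwise. Fix $\varepsilon$ with $\varepsilon^2=\varepsilon+1$, a square root $\sqrt\varepsilon$, nonzero $x,y\in\mathbb C$, and $\beta_\varepsilon\in\{e^{3\pi i/5},e^{-3\pi i/5}\}$ if $\varepsilon>0$, $\beta_\varepsilon\in\{e^{\pi i/5},e^{-\pi i/5}\}$ if $\varepsilon<0$. Structure morphisms: $\alpha_{X,Y,Z}:(X\otimes Y)\otimes Z\to X\otimes(Y\otimes Z)$ is the identity for $X,Y,Z\in I$ not all $\mathbf A$; $[\alpha_{\mathbf A,\mathbf A,\mathbf A}]_{\mathbf 1}=(1)$, $[\alpha_{\mathbf A,\mathbf A,\mathbf A}]_{\mathbf A}=\begin{pmatrix}\frac1\varepsilon&\frac x{\sqrt\varepsilon}\\\frac1{x\sqrt\varepsilon}&-\frac1\varepsilon\end{pmatrix}$; it is extended summand-wise ($(x_i\otimes y_j)\otimes z_k\to x_i\otimes(y_j\otimes z_k)$ by $\alpha_{x_i,y_j,z_k}$). $[c_{\mathbf A,\mathbf A}]_{\mathbf 1}=(\beta_\varepsilon^2)$, $[c_{\mathbf A,\mathbf A}]_{\mathbf A}=(\beta_\varepsilon)$; $\theta_{\mathbf A}=\beta_\varepsilon^{-2}\,id_{\mathbf A}$; $b_{\mathbf A}:\mathbf 1\to\mathbf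 A\otimes\mathbf A$ and $d_{\mathbf A}:\mathbf A\otimes\mathbf A\to\mathbf 1$ with $[b_{\mathbf A}]_{\mathbf 1}=(y\sqrt\varepsilon)$, $[d_{\mathbf A}]_{\mathbf 1}=(\sqrt\varepsilon/y)$. Evaluation $\{L\}_\xi$. A colouring of a link diagram $L=l_1\cup\dots\cup l_k$ is a map $\xi:\{l_1,\dots,l_k\}\to\{\mathbf 1,\mathbf A\}$. Delete the components coloured $\mathbf 1$ to get $L'$ (if $L'$ is empty, $\{L\}_\xi=1$). Cut $L'$ by vertical lines into layers $\lambda_1,\dots,\lambda_n$ (left to right), each containing horizontal arcs and one elementary piece. Assign: positive crossing $\mapsto c_{\mathbf A,\mathbf A}$, negative crossing $\mapsto c_{\mathbf A,\mathbf A}^{-1}$ (signs computed with both strands oriented left to right); left half-circle (both ends on the right) $\mapsto b_{\mathbf A}$; right half-circle (both ends on the left) $\mapsto d_{\mathbf A}$; positive (negative) loop, i.e. an arc with one kink whose crossing is positive (negative) $\mapsto\theta_{\mathbf A}$ ($\theta_{\mathbf A}^{-1}$); horizontal arc $\mapsto id_{\mathbf A}$. Tensoring from top to bottom with any bracketing gives $\mu_{\lambda_i}$; $\{L\}_\xi\in Hom(\mathbf 1,\mathbf 1)=\mathbb C$ is $\mu_{\lambda_1}\circ\tau_1\circ\mu_{\lambda_2}\circ\dots\circ\tau_{n-1}\circ\mu_{\lambda_n}$ with $\tau_i$ the composite of associativity isomorphisms matching bracketings. Invariant of 3-manifolds. A framed link $(\mathbb L,\mathbb F)$ is an unoriented link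 with ordered components and integers $\mathbb F=(f_1,\dots,f_k)$; a diagram of it is a diagram $L=l_1\cup\dots\cup l_k$ of $\mathbb L$ with $w(l_i)=f_i$, where $w(l_i)$ is the number of positive minus the number of negative self-crossings of $l_i$. Its signature $\sigma$ is the signature (number of positive minus number of negative squares) of the symmetric matrix with diagonal $f_i$ and off-diagonal entries $lk(l_i,l_j)$. If $M$ is obtained from $S^3$ by surgery on $(\mathbb L,\mathbb F)$, then $$tr_\varepsilon(M)=\Delta^\sigma D^{-\sigma-k-1}\sum_\xi\varepsilon^{|\xi|_{\mathbf A}}\{L\}_\xi,\quad \Delta=1+\varepsilon^2\beta_\varepsilon^2,\ D=\sqrt{2+\varepsilon},$$ summing over all colourings, $|\xi|_{\mathbf A}$ being the number of components coloured $\mathbf A$; this does not depend on the framed link presenting $M$. *)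

(* Defs.v *)
From HB Require Import structures.
From mathcomp Require Import all_boot all_order all_algebra.
From mathcomp Require Import boolp classical_sets reals trigo exp.
From mathcomp Require Import complex.

Set Implicit Arguments.
Unset Strict Implicit.
Unset Printing Implicit Defensive.

Import Order.TTheory GRing.Theory Num.Theory.

Local Open Scope ring_scope.
Local Open Scope complex_scope.

(* The two generating objects: [One] is the unit 1, [Aa] is A. *)
Variant simple := One | Aa.

Definition bool_of_simple (s : simple) : bool := if s is Aa then true else false.
Definition simple_of_bool (b : bool) : simple := if b then Aa else One.
Lemma bool_of_simpleK : cancel bool_of_simple simple_of_bool.
Proof. by case. Qed.
HB.instance Definition _ := Finite.copy simple (can_type bool_of_simpleK).

Definition obj := seq simple.

(* The summands of x (x) z, in order. *)
Definition stens (x z : simple) : obj :=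
  match x, z with
  | One, _ => [:: z]
  | _, One => [:: x]
  | Aa, Aa => [:: One; Aa]
  end.

(* The n-th summand of X (x) Z is the m-th summand of x_i (x) z_r, where
   (i, r, m) is the n-th item of [addrs X Z]. *)
Definition addrs (X Z : obj) : seq (nat * nat * nat) :=
  [seq (ir.1, ir.2, m)
     | ir <- [seq (i, r) | i <- iota 0 (size X), r <- iota 0 (size Z)],
       m <- iota 0 (size (stens (nth One X ir.1) (nth One Z ir.2)))].

Definition addr (X Z : obj) (n : nat) : nat * nat * nat :=
  nth (0, 0, 0)%N (addrs X Z) n.

Definition tens (X Z : obj) : obj :=
  [seq nth One (stens (nth One X t.1.1) (nth One Z t.1.2)) t.2 | t <- addrs X Z].

(* A morphism x_1 + ... + x_n -> y_1 + ... + y_m: [coef f i j] is the number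
   a_i^j, significant for i < n and j < m only (0-based).  Every morphism built
   below has a_i^j = 0 when x_i <> y_j. *)
Record mor (C : Type) := Mor { dom : obj; cod : obj; coef : nat -> nat -> C }.

Section Category.
Variable C : fieldType.
Implicit Types f g : mor C.

(* The morphism whose pair of matrices ([f]_1, [f]_A) is (M1, MA), each given
   by the list of its rows: rows are indexed by the target and columns by the
   source. *)
Definition of_blocks (X Y : obj) (M1 MA : seq (seq C)) : mor C :=
  Mor X Y (fun i j =>
    let s := nth One X i in
    if s == nth One Y j then
      nth 0 (nth [::] (if s is One then M1 else MA) (count_mem s (take j Y)))
            (count_mem s (take i X))
    else 0).

Definition idm (X : obj) : mor C := Mor X X (fun i j => (i == j)%:R).

(* Left-to-right composition. *)
Definition comp f g : mor C :=
  Mor (dom f) (cod g)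
      (fun i k => \sum_(j < size (cod f)) coef f i j * coef g j k).

Definition tensm f g : mor C :=
  Mor (tens (dom f) (dom g)) (tens (cod f) (cod g)) (fun n n' =>
    let: (i, r, m) := addr (dom f) (dom g) n in
    let: (j, s, m') := addr (cod f) (cod g) n' in
    if [&& nth One (dom f) i == nth One (cod f) j,
           nth One (dom g) r == nth One (cod g) s & m == m']
    then coef f i j * coef g r s else 0).

End Category.

(* The data fixed in the construction of the category. *)
Record cat_data (R : realType) := CatData {
  eps : R;
  sqrt_eps : R[i];
  xpar : R[i];
  ypar : R[i];
  beta : R[i];
  epsE : eps ^+ 2 = eps + 1;
  sqrt_epsE : sqrt_eps ^+ 2 = eps%:C;
  xpar_neq0 : xpar != 0;
  ypar_neq0 : ypar != 0;
  betaE :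
    let cis (t : R) := cos t +i* sin t in
    if 0 < eps
    then beta = cis (3 * pi / 5) \/ beta = cis (- (3 * pi / 5))
    else beta = cis (pi / 5) \/ beta = cis (- (pi / 5))
}.

(* Oriented strands of a diagram: the component and the direction ([true] when
   the strand runs from left to right).  Links are unoriented; the directions
   are an auxiliary choice, used for linking numbers only. *)
Definition strand (T : Type) : Type := T * bool.
Definition flip (T : Type) (a : strand T) : strand T := (a.1, ~~ a.2).

(* Elementary pieces.  [Cross s a b] is a crossing with the strand a entering at
   the top left and b at the bottom left; s tells whether the crossing is
   positive when both strands are oriented from left to right.  [Cup a] is a left
   half-circle and [Cap a] a right half-circle, with a at the top.  [Loop s a] is
   an arc with one kink, positive when s is true. *)
Variant piece (T : Type) :=
  | Cross of bool & strand T & strand T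
  | Cup of strand T
  | Cap of strand T
  | Loop of bool & strand T.

(* A layer: the horizontal arcs above the piece, the piece, the arcs below, all
   listed from top to bottom. *)
Record layer (T : Type) := Layer {
  above : seq (strand T);
  pc : piece T;
  below : seq (strand T)
}.

Definition psrc (T : Type) (p : piece T) : seq (strand T) :=
  match p with
  | Cross _ a b => [:: a; b]
  | Cup _ => [::]
  | Cap a => [:: a; flip a]
  | Loop _ a => [:: a]
  end.

Definition ptgt (T : Type) (p : piece T) : seq (strand T) :=
  match p with
  | Cross _ a b => [:: b; a]
  | Cup a => [:: a; flip a]
  | Cap _ => [::]
  | Loop _ a => [:: a]
  end.

Definition lsrc (T : Type) (l : layer T) := above l ++ psrc (pc l) ++ below l.
Definition ltgt (T : Type) (l : layer T) := above l ++ ptgt (pc l) ++ below l.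

Fixpoint closes (T : Type) (st : seq (strand T)) (L : seq (layer T)) : Prop :=
  if L is l :: L' then lsrc l = st /\ closes (ltgt l) L' else st = [::].

Definition relabel_piece (T T' : Type) (h : T -> T') (p : piece T) : piece T' :=
  let hs (a : strand T) : strand T' := (h a.1, a.2) in
  match p with
  | Cross s a b => Cross s (hs a) (hs b)
  | Cup a => Cup (hs a)
  | Cap a => Cap (hs a)
  | Loop s a => Loop s (hs a)
  end.

Definition relabel (T T' : Type) (h : T -> T') (l : layer T) : layer T' :=
  let hs (a : strand T) : strand T' := (h a.1, a.2) in
  Layer (map hs (above l)) (relabel_piece h (pc l)) (map hs (below l)).

Definition has_cup (T : eqType) (i : T) (L : seq (layer T)) : bool :=
  has (fun l => if pc l is Cup a then a.1 == i else false) L.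

(* L is a diagram of a link with components labelled by T.  The layers fit
   together, every label is used, and each label is carried by one closed curve
   only: any labelling of the same picture by two labels, constant along the
   curves, factors through the labelling of L. *)
Definition link_diagram (T : eqType) (L : seq (layer T)) : Prop :=
  [/\ closes [::] L,
      forall i : T, has_cup i L
    & forall L' : seq (layer bool), closes [::] L' ->
        map (relabel (fun=> tt)) L' = map (relabel (fun=> tt)) L ->
        exists h : T -> bool, L' = map (relabel h) L].

Definition sgn_of (s : bool) : int := if s then 1 else - 1.

Definition self_writhe_at (T : eqType) (i : T) (l : layer T) : int :=
  match pc l with
  | Cross s a b =>
      if (a.1 == i) && (b.1 == i) then sgn_of (s (+) (a.2 != b.2)) else 0
  | Loop s a => if a.1 == i then sgn_of s else 0
  | _ => 0
  end.

Definition self_writhe (T : eqType) (L : seq (layer T)) (i : T) : int :=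
  \sum_(l <- L) self_writhe_at i l.

Definition mutual_sign_at (T : eqType) (i j : T) (l : layer T) : int :=
  if pc l is Cross s a b then
    if ((a.1 == i) && (b.1 == j)) || ((a.1 == j) && (b.1 == i))
    then sgn_of (s (+) (a.2 != b.2)) else 0
  else 0.

(* For the framing in which f_i = w(l_i).  Off the diagonal stands the linking
   number, half the sum of the signs of the mutual crossings. *)
Definition linking_matrix (R : realType) (k : nat) (L : seq (layer 'I_k)) :
    'M[R]_k :=
  \matrix_(i, j) if i == j then (self_writhe L i)%:~R
                 else (\sum_(l <- L) mutual_sign_at i j l)%:~R / 2.

(* Positive minus negative squares after a linear change of variables bringing
   the quadratic form of a symmetric matrix to a combination of squares; the
   number is unique by Sylvester's law of inertia. *)
Definition is_signature (R : realType) (k : nat) (M : 'M[R]_k) (s : int) : Prop :=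
  exists (P : 'M[R]_k) (d : 'rV[R]_k),
    [/\ P \in unitmx, P *m M *m P^T = diag_mx d
      & s = #|[set i | 0 < d 0 i]|%:Z - #|[set i | d 0 i < 0]|%:Z].

Definition signature (R : realType) (k : nat) (M : 'M[R]_k) : int :=
  xget 0 (fun s => is_signature M s).

Section Invariant.
Variables (R : realType) (E : cat_data R).
Local Notation C := R[i].
Local Notation e := ((eps E)%:C).
Local Notation se := (sqrt_eps E).
Local Notation b := (beta E).

Definition objA : obj := [:: Aa].
Definition objAA : obj := tens objA objA.

(* The associator for simple objects, as a morphism from (u (x) v) (x) w to
   u (x) (v (x) w); these two objects are always the same tuple, and both are
   A + 1 + A if u = v = w = A. *)
Definition alpha (u v w : simple) : mor C :=
  let X := tens (stens u v) [:: w] in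
  let Y := tens [:: u] (stens v w) in
  if [&& u == Aa, v == Aa & w == Aa] then
    of_blocks X Y
      [:: [:: 1]]
      [:: [:: e^-1;                 xpar E / se];
          [:: (xpar E * se)^-1;     - e^-1]]
  else Mor X Y (coef (idm C X)).

(* The matrix of alpha_{A,A,A} is an involution since e^-2 + e^-1 = 1. *)
Definition alpha_inv (u v w : simple) : mor C :=
  Mor (cod (alpha u v w)) (dom (alpha u v w)) (coef (alpha u v w)).

(* The n-th summand of (X (x) Y) (x) Z (resp. of X (x) (Y (x) Z)) comes from
   the summands x_i, y_j, z_k, and has some position in (x_i (x) y_j) (x) z_k
   (resp. in x_i (x) (y_j (x) z_k)): these functions return ((i, j, k), pos). *)
Definition posl (X Y Z : obj) (n : nat) : (nat * nat * nat) * nat :=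
  let: (u, k, m) := addr (tens X Y) Z n in
  let: (i, j, l) := addr X Y u in
  ((i, j, k),
   index (l, 0%N, m)
     (addrs (stens (nth One X i) (nth One Y j)) [:: nth One Z k])).

Definition posr (X Y Z : obj) (n : nat) : (nat * nat * nat) * nat :=
  let: (i, v, m) := addr X (tens Y Z) n in
  let: (j, k, l) := addr Y Z v in
  ((i, j, k),
   index (0%N, l, m)
     (addrs [:: nth One X i] (stens (nth One Y j) (nth One Z k)))).

Definition assoc (X Y Z : obj) : mor C :=
  Mor (tens (tens X Y) Z) (tens X (tens Y Z)) (fun n n' =>
    let: ((i, j, k), p) := posl X Y Z n in
    let: (ijk', p') := posr X Y Z n' in
    if (i, j, k) == ijk'
    then coef (alpha (nth One X i) (nth One Y j) (nth One Z k)) p p' else 0).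

Definition assoc_inv (X Y Z : obj) : mor C :=
  Mor (tens X (tens Y Z)) (tens (tens X Y) Z) (fun n n' =>
    let: ((i, j, k), p) := posr X Y Z n in
    let: (ijk', p') := posl X Y Z n' in
    if (i, j, k) == ijk'
    then coef (alpha_inv (nth One X i) (nth One Y j) (nth One Z k)) p p' else 0).

Definition braiding : mor C := of_blocks objAA objAA [:: [:: b ^+ 2]] [:: [:: b]].
Definition braiding_inv : mor C :=
  of_blocks objAA objAA [:: [:: b ^- 2]] [:: [:: b^-1]].
Definition twist : mor C := of_blocks objA objA [::] [:: [:: b ^- 2]].
Definition twist_inv : mor C := of_blocks objA objA [::] [:: [:: b ^+ 2]].
Definition coev : mor C :=
  of_blocks [:: One] objAA [:: [:: ypar E * se]] [:: [::]].
Definition evm : mor C := of_blocks objAA [:: One] [:: [:: se / ypar E]] [::].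

Definition piece_mor (T : Type) (p : piece T) : mor C :=
  match p with
  | Cross s _ _ => if s then braiding else braiding_inv
  | Cup _ => coev
  | Cap _ => evm
  | Loop s _ => if s then twist else twist_inv
  end.

(* A (x) (A (x) (... (x) A)), with n factors. *)
Definition Apow (n : nat) : obj := iter n (tens objA) [:: One].

Definition idA_tens (p : nat) (f : mor C) : mor C :=
  iter p (tensm (idm C objA)) f.

(* The factors of a layer are bracketed to the right: with p arcs above and q
   arcs below, the morphism of the layer is
   id_A (x) (... (id_A (x) (f (x) id_{Apow q}))). *)
Definition layer_mor (T : Type) (l : layer T) : mor C :=
  idA_tens (size (above l))
           (tensm (piece_mor (pc l)) (idm C (Apow (size (below l))))).

(* The source (target) of [layer_mor l] is bracketed as Apow, except for the
   factor A (x) A which occurs when two strands enter (leave) the piece.  The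
   next two isomorphisms go from the target of a layer to Apow, and from Apow
   to the source of a layer. *)
Definition rebracket_tgt (T : Type) (l : layer T) : mor C :=
  let Q := Apow (size (below l)) in
  idA_tens (size (above l))
    (if size (ptgt (pc l)) == 2%N then assoc objA objA Q
     else idm C (tens (cod (piece_mor (pc l))) Q)).

Definition rebracket_src (T : Type) (l : layer T) : mor C :=
  let Q := Apow (size (below l)) in
  idA_tens (size (above l))
    (if size (psrc (pc l)) == 2%N then assoc_inv objA objA Q
     else idm C (tens (dom (piece_mor (pc l))) Q)).

Definition tau (T : Type) (l l' : layer T) : mor C :=
  comp (rebracket_tgt l) (rebracket_src l').

Fixpoint eval_from (T : Type) (l : layer T) (L : seq (layer T)) : mor C :=
  if L is l' :: L' then comp (comp (layer_mor l) (tau l l')) (eval_from l' L')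
  else layer_mor l.

(* Removing the components coloured 1.  A layer whose piece meets a removed
   component has no elementary piece any more, and is dropped. *)
Definition uncolour (T : Type) (xi : T -> simple) (L : seq (layer T)) :
    seq (layer T) :=
  let isA (a : strand T) := xi a.1 == Aa in
  [seq Layer (filter isA (above l)) (pc l) (filter isA (below l))
     | l <- L & match pc l with
                | Cross _ a a' => isA a && isA a'
                | Cup a | Cap a | Loop _ a => isA a
                end].

Definition bracket (T : Type) (xi : T -> simple) (L : seq (layer T)) : C :=
  if uncolour xi L is l :: L' then coef (eval_from l L') 0%N 0%N else 1.

Definition Delta : C := 1 + e ^+ 2 * b ^+ 2.
Definition Dconst : C := (Num.sqrt (2 + eps E))%:C.

(* The value of the invariant tr on the closed 3-manifold presented by L. *)
Definition tr_diagram (k : nat) (L : seq (layer 'I_k)) : C :=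
  let sigma := signature (linking_matrix R L) in
  Delta ^ sigma * Dconst ^ (- sigma - k%:Z - 1) *
  \sum_(xi : {ffun 'I_k -> simple})
     e ^+ #|[set i | xi i == Aa]| * bracket xi L.

(* The lengths of the maximal runs of consecutive integers in an increasing
   sequence. *)
Fixpoint run_lengths (s : seq nat) : seq nat :=
  if s is i :: s' then
    if run_lengths s' is l :: ls then
      if head 0%N s' == i.+1 then l.+1 :: ls else 1%N :: l :: ls
    else [:: 1%N]
  else [::].

Definition cfun (s : seq nat) : C :=
  \prod_(l <- run_lengths s) ((-1) ^+ l.-1 / e ^ (l%:Z - 2)).

End Invariant.

(* Standard diagrams of the generalised Hopf link, drawn from left to right.
   U_i consists of a top strand [up i] and a bottom strand [dn i], and may carry
   kinks next to its left end, with signs [kinks i].  The two crossings of U_i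
   with its successor have the same sign [clasp i]: both signs give the Hopf
   link, which is unoriented. *)
Section Hopf.
Variables (T : Type) (kinks : T -> seq bool) (clasp : T -> bool).
Let up (i : T) : strand T := (i, true).
Let dn (i : T) : strand T := (i, false).

Fixpoint hopf_from (i : T) (s : seq T) : seq (layer T) :=
  if s is j :: s' then
    Layer [:: up i] (Cup (up j)) [:: dn i] ::
    [seq Layer [:: up i] (Loop z (up j)) [:: dn j; dn i] | z <- kinks j] ++
    [:: Layer [::] (Cross (clasp i) (up i) (up j)) [:: dn j; dn i];
        Layer [:: up j; up i] (Cross (clasp i) (dn j) (dn i)) [::];
        Layer [:: up j] (Cap (up i)) [:: dn j]] ++
    hopf_from j s'
  else [:: Layer [::] (Cap (up i)) [::]].

Definition hopf_layers (s : seq T) : seq (layer T) :=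
  if s is i :: s' then
    Layer [::] (Cup (up i)) [::] ::
    [seq Layer [::] (Loop z (up i)) [:: dn i] | z <- kinks i] ++
    hopf_from i s'
  else [::].

End Hopf.

Definition framed_hopf_diagram (k : nat) (F : 'I_k -> int)
    (L : seq (layer 'I_k)) : Prop :=
  exists (kinks : 'I_k -> seq bool) (clasp : 'I_k -> bool),
    L = hopf_layers kinks clasp (enum 'I_k) /\
    forall i, self_writhe L i = F i.

(* Main.v *)
Require Import Defs.
From mathcomp Require Import all_boot all_order all_algebra.
From mathcomp Require Import reals exp complex.
From mathcomp Require Import boolp trigo ring lra.

Set Implicit Arguments.
Unset Strict Implicit.
Unset Printing Implicit Defensive.

Import Order.TTheory GRing.Theory Num.Theory.
Local Open Scope ring_scope.
Local Open Scope complex_scope.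

(** Delete from the chain of circles the components coloured 1. What is left
    is a row of shorter chains, one for each maximal run of consecutive
    indices coloured A, and its value is a number obtained by reading the
    picture from left to right.

    Between two consecutive circles the picture consists of the two strands of
    one circle, carrying A (x) A = 1 + A. The value of what stands to the
    right is read off its coordinate at the summand 1, since nothing to the
    left can reach the summand A. So every circle acts by a scalar: the left
    half-circle that opens a run and the right one that closes it contribute
    [y sqrt eps] and [sqrt eps / y], together [eps]; a circle contributes
    [beta ^ (-2)] per unit of framing ([value_loops]); and clasping it with
    its predecessor contributes [beta ^ (+-4) / eps + beta ^ (+-2)]
    ([value_clasp]). The last number is [- 1 / eps] for both signs, because
    [beta ^ 4 + eps beta ^ 2 + 1 = 0] ([beta_relation]): the angle of [beta]
    is a multiple of pi / 5 and [eps] is [- 2] times the real part of its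
    square.

    Hence a run of length l has the value [eps (- 1 / eps) ^ (l - 1)] times
    its framing factors, and the first part is the factor of that run in [c];
    in the induction along the chain both sides obey the same recursion
    ([cfun_cons], [value_hopf_from]). Summing over the colourings is summing
    over the sets of components coloured A, sorted by cardinality
    ([sum_colourings], [sum_by_card]).

    The invariant may be computed from the standard diagram only if that is a
    diagram of a link with the prescribed components; for a closed picture
    this is automatic as soon as every label sits on exactly one left
    half-circle ([link_diagram_one_cup]), for every closed curve has one. *)

(** * Diagrams with one left half-circle per component *)

Definition cup_labels (T : Type) (L : seq (layer T)) : seq T :=
  pmap (fun l => if pc l is Cup a then Some a.1 else None) L.

Lemma cup_labels_relabel (T T' : Type) (h : T -> T') (L : seq (layer T)) :
  cup_labels (map (relabel h) L) = map h (cup_labels L).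
Proof. by elim: L => //= l L IH; case: (pc l) => /= *; rewrite IH. Qed.

Lemma has_cupE (T : eqType) (i : T) (L : seq (layer T)) :
  has_cup i L = (i \in cup_labels L).
Proof.
rewrite /has_cup /cup_labels.
elim: L => //= l L ->; case: (pc l) => //= a.
by rewrite in_cons eq_sym.
Qed.

Lemma cat_inj_size (A : Type) (s1 s2 t1 t2 : seq A) :
  size s1 = size t1 -> s1 ++ s2 = t1 ++ t2 -> s1 = t1 /\ s2 = t2.
Proof.
elim: s1 t1 => [|x s1 IH] [|y t1] //= [] /IH{}IH [-> /IH[-> ->]] //.
Qed.

(** A piece that is not a left half-circle inherits its labels from the strands
    entering the layer; so a relabelling known on the left of a layer and on its
    half-circle is known on its right. *)
Lemma layer_relabel_eq (T T' : Type) (h : T -> T') (l : layer T) (l' : layer T') :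
    relabel (fun=> tt) l' = relabel (fun=> tt) l ->
    (forall a a', pc l = Cup a -> pc l' = Cup a' -> a'.1 = h a.1) ->
    lsrc l' = [seq (h a.1, a.2) | a <- lsrc l] ->
  l' = relabel h l.
Proof.
case: l l' => [ab p be] [ab' p' be'] [] eab ep ebe hcup.
rewrite /lsrc /relabel /= !map_cat => /cat_inj_size [|-> esrc].
  by have := congr1 size eab; rewrite !size_map.
have [eps ->] : psrc p' = [seq (h a.1, a.2) | a <- psrc p] /\
    be' = [seq (h a.1, a.2) | a <- be].
  apply: cat_inj_size esrc; rewrite size_map.
  by move: ep; case: p {hcup} => [s a b|a|a|s a]; case: p' => [s' a' b'|a'|a'|s' a'].
congr Layer.
move: p p' ep eps hcup {esrc} => [s a b|a|a|s a] [s' a' b'|a'|a'|s' a'] //=.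
- by move=> [-> _ _] [-> ->].
- move=> [e2] _ /(_ a a' erefl erefl) e1.
  by congr Cup; case: a' e1 e2 => ? ? /= -> ->.
- by move=> _ [->].
- by move=> [-> _] [->].
Qed.

Lemma ltgt_relabel (T T' : Type) (h : T -> T') (l : layer T) :
  ltgt (relabel h l) = [seq (h a.1, a.2) | a <- ltgt l].
Proof.
by case: l => ab p be; rewrite /ltgt /relabel /= !map_cat; case: p.
Qed.

Lemma diagram_relabel_eq (T T' : Type) (h : T -> T') (st : seq (strand T))
    (L : seq (layer T)) (L' : seq (layer T')) :
    closes st L -> closes [seq (h a.1, a.2) | a <- st] L' ->
    map (relabel (fun=> tt)) L' = map (relabel (fun=> tt)) L ->
    cup_labels L' = map h (cup_labels L) ->
  L' = map (relabel h) L.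
Proof.
elim: L st L' => [|l L IH] st [|l' L'] // [<- cL] [src' cL'] eL ec.
have el := congr1 (head (relabel (fun=> tt) l)) eL.
have {}eL := congr1 behead eL.
have e1 : l' = relabel h l.
  apply: layer_relabel_eq => // -[a1 a2] [a'1 a'2] pa pa'.
  by move: ec; rewrite /cup_labels /= pa pa' /= => -[].
subst l'; congr cons.
apply: (IH (ltgt l)) => //; first by rewrite -ltgt_relabel.
by move: ec; rewrite /cup_labels /=; case: (pc l) => //= a [].
Qed.

Lemma uniq_map_exists (T : eqType) (T' : Type) (x0 : T') (s : seq T) (t : seq T') :
  uniq s -> size t = size s -> exists h : T -> T', t = map h s.
Proof.
move=> us est; exists (fun x => nth x0 t (index x s)).
rewrite -{1}(mkseq_nth x0 t) est /mkseq; apply/esym.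
case: s us est => // z s us est.
apply: (@eq_from_nth _ x0); rewrite ?size_map ?size_iota // => i lti.
by rewrite (nth_map z) ?(nth_map 0%N) ?size_iota // nth_iota // index_uniq.
Qed.

(** The map of labels demanded by [link_diagram] is read off the left
    half-circles; following the strands to the right forces it everywhere. *)
Lemma link_diagram_one_cup (T : eqType) (L : seq (layer T)) :
    closes [::] L -> uniq (cup_labels L) -> (forall i, i \in cup_labels L) ->
  link_diagram L.
Proof.
move=> cL uL allL; split=> // [i|L' cL' eL']; first by rewrite has_cupE.
have [|h eh] := @uniq_map_exists T bool false _ (cup_labels L') uL.
  have := congr1 (fun M => size (cup_labels M)) eL'.
  by rewrite !cup_labels_relabel !size_map.
by exists h; apply: (diagram_relabel_eq cL).
Qed.

(** * The diagram of the generalised Hopf link *)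

Section HopfDiagram.
Variables (T : eqType) (kinks : T -> seq bool) (clasp : T -> bool).

Lemma closes_loops (st : seq (strand T)) ab (a : strand T) be zs L :
  st = ab ++ a :: be -> closes st L ->
  closes st ([seq Layer ab (Loop z a) be | z <- zs] ++ L).
Proof. by move=> -> cL; elim: zs => //= z zs IH. Qed.

Lemma closes_hopf_from i s :
  closes [:: (i, true); (i, false)] (hopf_from kinks clasp i s).
Proof.
elim: s i => [|j s IH] i //=.
split=> //; apply: closes_loops => //; do 3!split=> //; exact: IH.
Qed.

Lemma closes_hopf s : closes [::] (hopf_layers kinks clasp s).
Proof.
by case: s => //= i s; split=> //; apply: closes_loops => //; apply: closes_hopf_from.
Qed.

Lemma cup_labels_loops ab (a : strand T) be zs L :
  cup_labels ([seq Layer ab (Loop z a) be | z <- zs] ++ L) = cup_labels L.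
Proof. by elim: zs. Qed.

Lemma cup_labels_hopf s : cup_labels (hopf_layers kinks clasp s) = s.
Proof.
case: s => //= i s; rewrite /cup_labels /= -/(cup_labels _) cup_labels_loops; congr cons.
elim: s i => //= j s IH i.
by rewrite {1}/cup_labels /= -/(cup_labels _) cup_labels_loops /cup_labels /= -/(cup_labels _) IH.
Qed.

Lemma self_writhe_cat (L1 L2 : seq (layer T)) t :
  self_writhe (L1 ++ L2) t = self_writhe L1 t + self_writhe L2 t.
Proof. exact: big_cat. Qed.

Lemma self_writhe_cons l (L : seq (layer T)) t :
  self_writhe (l :: L) t = self_writhe_at t l + self_writhe L t.
Proof. exact: big_cons. Qed.

Definition kink_sum (zs : seq bool) : int := \sum_(z <- zs) sgn_of z.

Lemma self_writhe_loops ab (a : strand T) be zs t :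
  self_writhe [seq Layer ab (Loop z a) be | z <- zs] t =
  if a.1 == t then kink_sum zs else 0.
Proof.
rewrite /self_writhe big_map /self_writhe_at /=.
by case: ifP => // _; rewrite big1.
Qed.

Lemma self_writhe_hopf_from i s t : uniq (i :: s) ->
  self_writhe (hopf_from kinks clasp i s) t =
  if t \in s then kink_sum (kinks t) else 0.
Proof.
elim: s i => [|j s IH] i; first by rewrite /self_writhe big_seq1.
rewrite [uniq _]/= in_cons negb_or => /and3P[/andP[neq_ij _] js us].
rewrite /= !(self_writhe_cons, self_writhe_cat) IH ?self_writhe_loops; last first.
  by rewrite /= js.
rewrite /self_writhe_at /= in_cons (eq_sym t).
have -> : (i == t) && (j == t) = false.
  by apply: contraNF neq_ij => /andP[/eqP-> /eqP->].
have -> : (j == t) && (i == t) = false.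
  by apply: contraNF neq_ij => /andP[/eqP-> /eqP->].
rewrite !add0r; have [<-|_] := eqVneq j t; last by rewrite add0r.
by rewrite (negPf js) addr0.
Qed.

Lemma self_writhe_hopf s t : uniq s -> t \in s ->
  self_writhe (hopf_layers kinks clasp s) t = kink_sum (kinks t).
Proof.
case: s => // i s us; rewrite in_cons (eq_sym t) /= => ts.
rewrite self_writhe_cons self_writhe_cat self_writhe_loops self_writhe_hopf_from //.
rewrite /self_writhe_at /= add0r; move: ts; have [<- _|_ /= ->] := eqVneq i t.
  by case/andP: us => /negPf -> _; rewrite addr0.
by rewrite add0r.
Qed.

End HopfDiagram.

Lemma link_diagram_hopf (k : nat) (kinks : 'I_k -> seq bool) (clasp : 'I_k -> bool) :
  link_diagram (hopf_layers kinks clasp (enum 'I_k)).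
Proof.
apply: link_diagram_one_cup; first exact: closes_hopf.
  by rewrite cup_labels_hopf enum_uniq.
by move=> i; rewrite cup_labels_hopf mem_enum.
Qed.

(** * The relation between beta and eps *)

(** With [p = cos (pi / 5)], comparing [cos 3a] and [- cos 2a] at [a = pi / 5]
    gives [(p + 1) (4 p ^ 2 - 2 p - 1) = 0]; the sign of [p] selects the factor.
    Thus [2 p] is the golden ratio. *)
Lemma cos_pi5 (R : realType) (p := cos (pi / 5 : R)) :
  [/\ 1 < 2 * p, 4 * p ^+ 2 = 2 * p + 1 & 2 * cos (3 * pi / 5 : R) = 1 - 2 * p].
Proof.
have pi0 := pi_gt0 R.
have p0 : 0 < p by apply: cos_gt0_pihalf; apply/andP; split; lra.
have ps : p ^+ 2 + sin (pi / 5 : R) ^+ 2 = 1 by rewrite /p cos2Dsin2.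
have c2 : cos (2 * (pi / 5) : R) = 2 * p ^+ 2 - 1.
  rewrite mulr_natl mulr2n cosD -!expr2 -/p; lra.
have c3 : cos (3 * pi / 5 : R) = 1 - 2 * p ^+ 2.
  have -> : 3 * pi / 5 = - (2 * (pi / 5)) + pi :> R by field.
  rewrite cosDpi cosN c2; ring.
have c3' : cos (3 * pi / 5 : R) = 4 * p ^+ 3 - 3 * p.
  have -> : 3 * pi / 5 = pi / 5 + (pi / 5 + pi / 5) :> R by field.
  rewrite cosD [cos (_ + _)]cosD sinD -/p.
  have -> : sin (pi / 5 : R) * (sin (pi / 5) * p + p * sin (pi / 5)) =
            2 * p * sin (pi / 5) ^+ 2 by ring.
  rewrite -!expr2; have -> : sin (pi / 5 : R) ^+ 2 = 1 - p ^+ 2 by lra.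
  ring.
have quad : 4 * p ^+ 2 = 2 * p + 1.
  have p1 : p + 1 != 0 by lra.
  apply: (mulfI p1); apply/eqP; rewrite -subr_eq0; apply/eqP.
  have -> : (p + 1) * (4 * p ^+ 2) - (p + 1) * (2 * p + 1) =
    (4 * p ^+ 3 - 3 * p) - (1 - 2 * p ^+ 2) by ring.
  by rewrite -c3' c3 subrr.
split=> //; last by rewrite c3; lra.
nra.
Qed.

Section GoldenRelation.
Variables (R : realType) (E : cat_data R).

Lemma eps_roots (p : R) : 1 < 2 * p -> 4 * p ^+ 2 = 2 * p + 1 ->
  eps E = if 0 < eps E then 2 * p else 1 - 2 * p.
Proof.
move=> p1 pE; have eE := epsE E.
have /eqP : (eps E - 2 * p) * (eps E - (1 - 2 * p)) = 0.
  by rewrite mulrBl !mulrBr -expr2 eE; lra.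
rewrite mulf_eq0 !subr_eq0; case: ltP => e0 /orP[] /eqP; lra.
Qed.

(** [eps = - (beta ^ 2 + beta ^ (-2))]; the two ranges of angles of [beta] are
    the ones that match the two roots of [x ^ 2 = x + 1]. *)
Lemma beta_circle : exists c s : R,
  [/\ beta E = c +i* s, c ^+ 2 + s ^+ 2 = 1 & eps E = 2 - 4 * c ^+ 2].
Proof.
have [p1 pE rE] := cos_pi5 R; have eE := eps_roots p1 pE.
have := betaE E; cbv zeta; move: eE; set p := cos (pi / 5) in p1 pE rE *.
case: ifP => _ -> [] ->; do 2![eexists]; split; try reflexivity;
  rewrite ?cos2Dsin2 // ?cosN.
- have -> : 4 * cos (3 * pi / 5 : R) ^+ 2 = (2 * cos (3 * pi / 5)) ^+ 2 by ring.
  by rewrite rE; lra.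
- have -> : 4 * cos (3 * pi / 5 : R) ^+ 2 = (2 * cos (3 * pi / 5)) ^+ 2 by ring.
  by rewrite rE; lra.
- rewrite -/p; lra.
- rewrite -/p; lra.
Qed.

Lemma beta_relation : beta E ^+ 4 + (eps E)%:C * beta E ^+ 2 + 1 = 0.
Proof.
have [c [s [-> cs ->]]] := beta_circle.
rewrite -[4%N]/(2 * 2)%N exprM !expr2; apply/eqP; rewrite eq_complex /=.
have s2 : s * s = 1 - c * c by rewrite -!expr2 -cs; ring.
apply/andP; split; apply/eqP; ring: s2.
Qed.

Lemma beta_neq0 : beta E != 0.
Proof.
apply/eqP => b0; move/eqP: beta_relation.
by rewrite b0 !expr0n /= mulr0 !add0r oner_eq0.
Qed.

Lemma eps_neq0 : (eps E)%:C != 0.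
Proof.
rewrite fmorph_eq0; apply/eqP => e0; have := epsE E.
by rewrite e0 expr0n add0r => /esym/eqP; rewrite oner_eq0.
Qed.

Lemma sqrt_eps_neq0 : sqrt_eps E != 0.
Proof.
apply/eqP => s0; have := sqrt_epsE E.
by rewrite s0 expr0n => /esym/eqP; rewrite (negPf eps_neq0).
Qed.

End GoldenRelation.

(** * Evaluation of closed diagrams by transfer matrices *)

Section Composition.
Variable C : fieldType.
Implicit Types f g h : mor C.

Lemma compmA f g h : Defs.comp (Defs.comp f g) h = Defs.comp f (Defs.comp g h).
Proof.
rewrite /Defs.comp /=; congr Mor; apply/funext=> i; apply/funext=> k /=.
under eq_bigr do rewrite mulr_suml.
rewrite exchange_big; apply: eq_bigr => j _; rewrite mulr_sumr.
by apply: eq_bigr => m _; rewrite mulrA.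
Qed.

Lemma coef_comp f g i k :
  coef (Defs.comp f g) i k =
  foldr (fun j a => coef f i j * coef g j k + a) 0 (iota 0 (size (cod f))).
Proof.
rewrite /= -(big_mkord xpredT (fun j => coef f i j * coef g j k)).
rewrite /index_iota subn0.
by elim: (iota _ _) => [|j s IH]; rewrite ?big_nil ?big_cons //= IH.
Qed.

Lemma comp_foldr f g :
  Defs.comp f g = Mor (dom f) (cod g) (fun i k =>
    foldr (fun j a => coef f i j * coef g j k + a) 0 (iota 0 (size (cod f)))).
Proof.
by rewrite {1}/Defs.comp; congr Mor; apply/funext=> i; apply/funext=> k;
   rewrite -coef_comp.
Qed.

Lemma coef_comp1 X f i k : (i < size X)%N ->
  coef (Defs.comp (idm C X) f) i k = coef f i k.
Proof.
move=> iX; rewrite /= (bigD1 (Ordinal iX)) //= eqxx mul1r big1 ?addr0 // => j ji.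
by rewrite eq_sym (negPf (ji : j != i :> nat)) mul0r.
Qed.

End Composition.

(** A layer that is dropped does not change the tuple of the remaining strands,
    as the one strand that may survive in its piece passes straight through. *)
Lemma closes_uncolour (T : Type) (xi : T -> simple) st (L : seq (layer T)) :
  closes st L ->
  closes [seq a <- st | xi a.1 == Aa] (uncolour xi L).
Proof.
elim: L st => [st -> //|[ab p be] L IH] st [/= <- {}/IH].
rewrite /lsrc /ltgt /uncolour /= !filter_cat.
case: p => [s a b|a|a|s a] /=; case: (xi a.1 =P Aa) => xa //=;
  try (case: (xi b.1 =P Aa) => xb //=); by split; rewrite /lsrc /= ?xa ?xb.
Qed.

Lemma closes_first (T : Type) (l : layer T) L :
  closes [::] (l :: L) -> exists a, l = Layer [::] (Cup a) [::].
Proof.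
by case: l => [[|a0 ab] [s a b|a|a|s a] [|b0 be]] [] //= _; exists a.
Qed.

Lemma closes_last (T : Type) st (l : layer T) :
  closes st [:: l] -> exists a, l = Layer [::] (Cap a) [::].
Proof.
by case: l => [[|a0 ab] [s a b|a|a|s a] [|b0 be]] [] //= _; exists a.
Qed.

Section Value.
Variables (R : realType) (E : cat_data R).

(** The layer read between right-bracketed powers of A on both sides. *)
Definition transfer (T : Type) (l : layer T) : mor R[i] :=
  Defs.comp (Defs.comp (rebracket_src E l) (layer_mor E l)) (rebracket_tgt E l).

(** Since a closed diagram ends in the unit object, what stands to the right of
    a vertical line is a morphism to 1, i.e. a column vector indexed by the
    summands of the power of A on that line.  [value L] is this vector for the
    layers [L], built from right to left. *)
Fixpoint value (T : Type) (L : seq (layer T)) : nat -> R[i] :=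
  if L is l :: L' then fun i =>
    foldr (fun j a => coef (transfer l) i j * value L' j + a) 0
      (iota 0 (size (cod (transfer l))))
  else fun i => (i == 0)%:R.

(** In [eval_from] each rebracketing [tau] joins two layers; splitting it in its
    two halves and giving one to each neighbour turns the composite into a
    product of transfer matrices.  The half that is missing at the right end is
    an identity, the last layer being a right half-circle alone. *)
Lemma value_eval (T : Type) st (l : layer T) (L : seq (layer T)) i :
  closes st (l :: L) ->
  coef (Defs.comp (rebracket_src E l) (eval_from E l L)) i 0 = value (l :: L) i.
Proof.
elim: L l st i => [|l' L IH] l st i.
  case/closes_last=> a ->; set l0 := Layer _ _ _.
  (* The last layer ends in the one-term tuple 1, so the sum has one term. *)
  transitivity (coef (transfer l0) i 0 * 1 + 0); last by [].
  rewrite mulr1 addr0 /transfer [RHS]coef_comp.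
  transitivity (coef (Defs.comp (rebracket_src E l0) (layer_mor E l0)) i 0 * 1 + 0).
    by rewrite mulr1 addr0.
  by [].
case=> _; rewrite -/(closes (ltgt l) (l' :: L)) => cL.
have -> : Defs.comp (rebracket_src E l) (eval_from E l (l' :: L)) =
    Defs.comp (transfer l) (Defs.comp (rebracket_src E l') (eval_from E l' L)).
  by rewrite /= /tau /transfer !compmA.
rewrite coef_comp -[RHS]/(foldr _ _ _); congr foldr; apply/funext=> j.
by rewrite (IH _ _ _ cL).
Qed.

Lemma bracketE (T : Type) (xi : T -> simple) (L : seq (layer T)) :
  closes [::] L -> bracket E xi L = value (uncolour xi L) 0.
Proof.
move=> /(closes_uncolour xi); rewrite /bracket.
case: (uncolour xi L) => [//|l M] /= cM.
rewrite -[RHS]/(value (l :: M) 0) -(value_eval 0 cM).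
have [a ->] := closes_first cM.
by rewrite /rebracket_src coef_comp1.
Qed.

End Value.

Arguments value {R} E {T} L i : simpl never.

(** * The layers of a chain *)

(** Two strands carry A (x) A = 1 + A and four strands carry 1 + A + A + 1 + A, so
    the summands equal to 1 have the numbers 0, and 0 and 3 respectively.  All
    morphisms preserve the symbol of a summand, hence only these coordinates
    occur.  The digit in the name of a lemma counts the strands beside the piece.
    The copy number 0 comes from 1 in the two lower strands, the copy
    number 3 from A. *)
Section LayerValues.
Variables (R : realType) (E : cat_data R) (T : Type).
Local Notation e := ((eps E)%:C).
Local Notation b := (beta E).
Implicit Types (a c d f : strand T) (L : seq (layer T)).

Lemma value_cons (l : layer T) L i :
  value E (l :: L) i =
  foldr (fun j s => coef (transfer E l) i j * value E L j + s) 0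
    (iota 0 (size (cod (transfer E l)))).
Proof. by []. Qed.

(** The positions, bracketings and 0-1 entries are closed terms of [nat] and
    [seq], so a row of a transfer matrix is found by computation, provided that
    the operations of the field and its structures stay folded. *)
Ltac layer_entries :=
  rewrite value_cons /transfer !comp_foldr;
  match goal with |- context [value E ?L] => move: (value E L) => w end;
  match goal with |- ?l = ?r =>
    let l' := eval cbv -[GRing.add GRing.mul GRing.one GRing.zero GRing.exp
      GRing.inv GRing.opp GRing.natmul real_complex_def xpar sqrt_eps ypar beta
      eps complex_complex__canonical__GRing_Field
      complex_complex__canonical__GRing_PzSemiRing
      complex_complex__canonical__GRing_UnitRing
      reals_Real__to__GRing_Field reals_Real__to__GRing_PzRing
      reals_Real__to__Num_RealField GRing_Field__to__Algebra_BaseAddUMagma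
      GRing_Field__to__GRing_PzSemiRing
      GRing_PzSemiRing__to__Algebra_BaseAddMagma
      GRing_PzSemiRing__to__Algebra_BaseAddUMagma
      GRing_UnitRing__to__Algebra_BaseZmodule] in l in
    change (l' = r) end.

Lemma value_cup0 a L :
  value E (Layer [::] (Cup a) [::] :: L) 0 = ypar E * sqrt_eps E * value E L 0.
Proof. layer_entries. ring. Qed.

Lemma value_cap0 a L :
  value E (Layer [::] (Cap a) [::] :: L) 0 = sqrt_eps E / ypar E * value E L 0.
Proof. layer_entries. ring. Qed.

Lemma value_loop1 z a c L :
  value E (Layer [::] (Loop z a) [:: c] :: L) 0 =
  (b ^ (2 * sgn_of z))^-1 * value E L 0.
Proof.
rewrite [b ^ _](_ : _ = if z then b ^+ 2 else b ^- 2); last by case: z.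
case: z; layer_entries; rewrite ?invrK; ring.
Qed.

(** The first column of the associator enters here, because the new half-circle
    is born in the middle of the four strands. *)
Lemma value_cup2 a c d L :
  value E (Layer [:: a] (Cup c) [:: d] :: L) 0 =
  ypar E * sqrt_eps E / e * value E L 0 + ypar E / xpar E * value E L 3.
Proof.
layer_entries. field.
by rewrite xpar_neq0 sqrt_eps_neq0 eps_neq0.
Qed.

Lemma value_cap2 a c d L :
  value E (Layer [:: a] (Cap c) [:: d] :: L) 0 =
    sqrt_eps E / ypar E / e * value E L 0 /\
  value E (Layer [:: a] (Cap c) [:: d] :: L) 3 =
    xpar E / ypar E * value E L 0.
Proof.
split; layer_entries; first ring.
field.
by rewrite ypar_neq0 sqrt_eps_neq0 ?eps_neq0.
Qed.

Lemma value_loop3 z a c d f L i : i \in [:: 0; 3]%N ->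
  value E (Layer [:: a] (Loop z c) [:: d; f] :: L) i =
  (b ^ (2 * sgn_of z))^-1 * value E L i.
Proof.
rewrite [b ^ _](_ : _ = if z then b ^+ 2 else b ^- 2); last by case: z.
by rewrite !inE => /orP[] /eqP->; case: z; layer_entries; rewrite ?invrK; ring.
Qed.

Lemma value_cross_top z a c d f L :
  value E (Layer [::] (Cross z a c) [:: d; f] :: L) 0 =
    b ^ (2 * sgn_of z) * value E L 0 /\
  value E (Layer [::] (Cross z a c) [:: d; f] :: L) 3 =
    b ^ sgn_of z * value E L 3.
Proof.
rewrite [b ^ _](_ : _ = if z then b ^+ 2 else b ^- 2); last by case: z.
rewrite [b ^ sgn_of z](_ : _ = if z then b else b^-1); last by case: z.
by case: z; split; layer_entries; ring.
Qed.

Lemma value_cross_bottom z a c d f L :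
  value E (Layer [:: a; c] (Cross z d f) [::] :: L) 0 =
    b ^ (2 * sgn_of z) * value E L 0 /\
  value E (Layer [:: a; c] (Cross z d f) [::] :: L) 3 =
    b ^ sgn_of z * value E L 3.
Proof.
rewrite [b ^ _](_ : _ = if z then b ^+ 2 else b ^- 2); last by case: z.
rewrite [b ^ sgn_of z](_ : _ = if z then b else b^-1); last by case: z.
by case: z; split; layer_entries; ring.
Qed.
End LayerValues.

(** * Runs of linked circles *)

Section HopfValue.
Variables (R : realType) (E : cat_data R).
Local Notation e := ((eps E)%:C).
Local Notation b := (beta E).

(** The number by which a circle is multiplied when a further circle is hooked
    into it: the S-matrix quotient of the Hopf link by the unknot.  Both signs
    give the same value since [beta ^ 4 + eps beta ^ 2 + 1] is palindromic. *)
Lemma clasp_relation z : (b ^ (2 * sgn_of z)) ^+ 2 / e + (b ^ sgn_of z) ^+ 2 = - e^-1.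
Proof.
have b0 := beta_neq0 E; have e0 := eps_neq0 E; have rel := beta_relation E.
have -> : b ^ (2 * sgn_of z) = (b ^ sgn_of z) ^+ 2 by rewrite mulrC -exprz_exp.
suff main : (b ^ sgn_of z) ^+ 4 + e * (b ^ sgn_of z) ^+ 2 + 1 = 0.
  have -> : - e^-1 = - e^-1 + ((b ^ sgn_of z) ^+ 4 + e * (b ^ sgn_of z) ^+ 2 + 1) / e.
    by rewrite main mul0r addr0.
  by field.
case: z; first by rewrite expr1z.
rewrite [b ^ _](_ : _ = b^-1) //; apply: (mulfI (expf_neq0 4 b0)).
by rewrite mulr0 -rel; field.
Qed.

Lemma value_loops (T : Type) ab (a : strand T) be (i : nat) zs L :
    (forall z M, value E (Layer ab (Loop z a) be :: M) i =
                 (b ^ (2 * sgn_of z))^-1 * value E M i) ->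
  value E ([seq Layer ab (Loop z a) be | z <- zs] ++ L) i =
  (b ^ (2 * kink_sum zs))^-1 * value E L i.
Proof.
move=> loopE; elim: zs => [|z zs IH].
  by rewrite /kink_sum big_nil mulr0 expr0z invr1 mul1r.
rewrite [_ ++ _]/= loopE IH /kink_sum big_cons mulrDr expfzDr ?beta_neq0 //.
by rewrite invfM mulrA.
Qed.

(** The two summands 1 of the four strands are summed over, each weighted by the
    entries of the associator at the birth of the new circle and at the death
    of the old one, and by the square of the braiding eigenvalue (the two
    crossings of the clasp act on different pairs of strands, but both are
    diagonal with the same eigenvalues on these summands). *)
Lemma value_clasp (T : Type) (a a' c c' : strand T) zs z L :
  value E (Layer [:: a] (Cup c) [:: a'] ::
    [seq Layer [:: a] (Loop w c) [:: c'; a'] | w <- zs] ++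
    [:: Layer [::] (Cross z a c) [:: c'; a'];
        Layer [:: c; a] (Cross z c' a') [::];
        Layer [:: c] (Cap a) [:: c']] ++ L) 0 =
  - e^-1 * (b ^ (2 * kink_sum zs))^-1 * value E L 0.
Proof.
have loops i : i \in [:: 0; 3]%N -> forall M, _ := fun i03 M =>
  value_loops zs M (fun w N => value_loop3 E w a c c' a' N i03).
rewrite value_cup2 (loops 0%N) // (loops 3%N) //.
rewrite !cat_cons cat0s.
rewrite (proj1 (value_cross_top E z _ _ _ _ _)) (proj2 (value_cross_top E z _ _ _ _ _)).
rewrite (proj1 (value_cross_bottom E z _ _ _ _ _)) (proj2 (value_cross_bottom E z _ _ _ _ _)).
rewrite (proj1 (value_cap2 E _ _ _ _)) (proj2 (value_cap2 E _ _ _ _)).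
rewrite -(clasp_relation z) -sqrt_epsE.
have se0 := sqrt_eps_neq0 E.
set B2 := b ^ (2 * sgn_of z); set B := b ^ sgn_of z.
set t := (b ^ _)^-1; field.
by rewrite xpar_neq0 ypar_neq0 se0.
Qed.

Lemma run_lengths_gt0 s : all (leq 1) (run_lengths s).
Proof.
elim: s => //= i s; case: (run_lengths s) => [|l ls] //= /andP[l0 als].
by case: ifP => _ /=; rewrite ?l0 als.
Qed.

Lemma run_lengths_nil s : (run_lengths s == [::]) = (s == [::]).
Proof. by case: s => //= i s; case: (run_lengths s) => // l ls; case: ifP. Qed.

Lemma cfun_nil : cfun E [::] = 1.
Proof. exact: big_nil. Qed.

(** Lengthening a run by one multiplies its factor by [- 1 / eps], and a new run
    of length 1 has the factor [eps].  The default 0 of [head] cannot be a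
    successor, so the empty tail counts as a gap. *)
Lemma cfun_cons i s :
  cfun E (i :: s) = (if head 0%N s == i.+1 then - e^-1 else e) * cfun E s.
Proof.
have e0 := eps_neq0 E; rewrite /cfun /=.
have single : (-1) ^+ (1%N.-1) / e ^ (1%N%:Z - 2) = e :> R[i].
  by rewrite (_ : 1%N%:Z - 2 = -1) // expr0 mul1r exprN1 invrK.
have := run_lengths_gt0 s; have := run_lengths_nil s.
case: (run_lengths s) => [/esym/eqP-> _|l ls _ /= /andP[l0 _]].
  by rewrite big_seq1 big_nil mulr1.
case: ifP => _; rewrite !big_cons.
  rewrite mulrA; congr (_ * _); case: l l0 => //= l _.
  rewrite exprS intS -addrA expfzDr // expr1z invfM.
  by rewrite mulrACA mulN1r [_ / e ^ _]mulrC.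
by congr (_ * _).
Qed.

End HopfValue.

Section ColouredHopf.
Variables (R : realType) (E : cat_data R) (T : Type).
Variables (kinks : T -> seq bool) (clasp : T -> bool) (v : T -> nat).
Variable xi : T -> simple.
Local Notation b := (beta E).
Local Notation isA := (fun j => xi j == Aa).

Lemma uncolour_cat (L1 L2 : seq (layer T)) :
  uncolour xi (L1 ++ L2) = uncolour xi L1 ++ uncolour xi L2.
Proof. by rewrite /uncolour filter_cat map_cat. Qed.

Lemma uncolour_loops ab (a : strand T) be zs :
  uncolour xi [seq Layer ab (Loop z a) be | z <- zs] =
  if xi a.1 == Aa
  then [seq Layer [seq c <- ab | xi c.1 == Aa] (Loop z a)
                  [seq c <- be | xi c.1 == Aa] | z <- zs]
  else [::].
Proof.
rewrite /uncolour; case: ifP => xa; last first.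
  by elim: zs => //= z zs IH; rewrite xa.
by elim: zs => //= z zs IH; rewrite xa /= IH.
Qed.

(** If the circle after [i] is coloured 1, the next circle coloured A has an index
    too large to continue the run of [i]. *)
Lemma head_after_gap (i j : T) s :
  path (fun a c => v c == (v a).+1) i (j :: s) ->
  (head 0%N [seq v t | t <- s & isA t] == (v i).+1) = false.
Proof.
move=> /= /andP[/eqP vj ps].
have gt_s : all (fun t => v j < v t)%N s.
  apply: (@order_path_min _ (relpre v ltn)); first by move=> ? ? ?; apply: ltn_trans.
  by apply: sub_path ps => a c /eqP /= ->.
elim: s {ps} gt_s => //= t s IH /andP[jt /IH{}IH].
by case: ifP => //= _; rewrite -vj gtn_eqF.
Qed.

(** [hopf_from i s] starts with the two strands of the circle [i] already open;
    the factor [ypar E * sqrt_eps E] of its left half-circle is restored on the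
    left-hand side so that the statement reproduces itself along the chain,
    whatever the colour of [i].  The kinks of [i] are already to the left. *)
Lemma value_hopf_from i s : path (fun a c => v c == (v a).+1) i s ->
  (if isA i then ypar E * sqrt_eps E else 1) *
    value E (uncolour xi (hopf_from kinks clasp i s)) 0 =
  cfun E [seq v j | j <- i :: s & isA j] *
    \prod_(j <- s | isA j) (b ^ (2 * kink_sum (kinks j)))^-1.
Proof.
elim: s i => [|j s IH] i psi.
  rewrite big_nil mulr1 /uncolour /=; case: ifP => _ /=.
    rewrite cfun_cons cfun_nil mulr1 /=.
    rewrite value_cap0 /= mulr1 -sqrt_epsE.
    have y0 := ypar_neq0 E; by field.
  by rewrite cfun_nil mul1r.
have gap := head_after_gap psi.
have /= /andP[/eqP vj /IH{IH}] := psi.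
(* The next circle contributes four groups of layers, uncoloured separately. *)
rewrite [hopf_from _ _ _ _]/= -[Layer _ (Cup _) _ :: _]cat1s.
rewrite -[[:: _, _, _ & hopf_from _ _ _ _]](cat_cons _ [:: _; _]).
rewrite !uncolour_cat uncolour_loops big_cons.
move: (uncolour xi (hopf_from kinks clasp j s)) => M.
rewrite /uncolour /=; case xiA: (xi i == Aa); case xjA: (xi j == Aa);
  rewrite /= ?xiA ?xjA /= => IH.
- rewrite value_clasp cfun_cons /= vj eqxx -vj [RHS]mulrACA -IH; ring.
- rewrite value_cap0 cfun_cons gap -[RHS]mulrA -IH -sqrt_epsE mul1r.
  by have y0 := ypar_neq0 E; field.
- rewrite value_cup0 (value_loops _ _ (fun z N => value_loop1 E z _ _ N)).
  by rewrite [RHS]mulrCA -IH; ring.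
- by [].
Qed.

Lemma value_hopf s :
    (if s is i :: s' then path (fun a c => v c == (v a).+1) i s' else true) ->
  value E (uncolour xi (hopf_layers kinks clasp s)) 0 =
  cfun E [seq v j | j <- s & isA j] *
    \prod_(j <- s | isA j) (b ^ (2 * kink_sum (kinks j)))^-1.
Proof.
case: s => [_|i s psi]; first by rewrite big_nil cfun_nil mulr1.
have := value_hopf_from psi; rewrite big_cons.
rewrite [hopf_layers _ _ _]/= -[Layer _ (Cup _) _ :: _]cat1s.
rewrite !uncolour_cat uncolour_loops /uncolour /=.
case: ifP => xiA /= valE; last by rewrite -valE mul1r.
rewrite value_cup0 (value_loops _ _ (fun z N => value_loop1 E z _ _ N)).
by rewrite [RHS]mulrCA -valE; ring.
Qed.

End ColouredHopf.

(** * The sum over the colourings *)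

Section Conclusion.
Variables (R : realType) (E : cat_data R).
Local Notation b := (beta E).

Lemma bracket_hopf (k : nat) (kinks : 'I_k -> seq bool) (clasp : 'I_k -> bool)
    (xi : 'I_k -> simple) (S := [set i | xi i == Aa]) :
  bracket E xi (hopf_layers kinks clasp (enum 'I_k)) =
  cfun E [seq val i | i <- enum S] /
    b ^ (\sum_(i in S) 2 * kink_sum (kinks i)).
Proof.
rewrite bracketE ?(value_hopf E kinks clasp (v := val)); first last.
- exact: closes_hopf.
- have succ_iota m n : path (fun a c => c == a.+1) n (iota n.+1 m).
    by elim: m n => //= m IH n; rewrite eqxx IH.
  have : path (fun a c => c == a.+1) (head 0%N (iota 0 k)) (behead (iota 0 k)).
    by case: (k) => // m; apply: succ_iota.
  by rewrite -val_enum_ord; case: (enum 'I_k) => //= i s; rewrite path_map.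
have enumS : [seq j <- enum 'I_k | xi j == Aa] = enum S.
  rewrite {1}/(enum 'I_k) -filter_predI /(enum S).
  by apply: eq_filter => i; rewrite !inE andbT.
rewrite -big_filter enumS; congr (_ * _).
rewrite -big_enum /=; elim: (enum S) => [|i s IH].
  by rewrite !big_nil expr0z invr1.
by rewrite !big_cons expfzDr ?beta_neq0 // invfM IH.
Qed.

Lemma Dconst_powR (n : int) :
  Dconst E ^ (- n) = (((eps E + 2) `^ (n%:~R / 2))%:C)^-1.
Proof.
have e2 : 0 <= eps E + 2.
  have -> : eps E + 2 = eps E ^+ 2 + 1 by rewrite epsE; ring.
  by rewrite addr_ge0 ?sqr_ge0.
rewrite mulrC powRrM powR12_sqrt // powR_intmul ?sqrtr_ge0 //.
by rewrite -invr_expz /Dconst addrC fmorphXz.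
Qed.

End Conclusion.

Lemma sum_colourings (C : nmodType) (T : finType) (G : {set T} -> C) :
  \sum_(xi : {ffun T -> simple}) G [set i | xi i == Aa] = \sum_(S : {set T}) G S.
Proof.
pose xi_of (S : {set T}) : {ffun T -> simple} := [ffun i => if i \in S then Aa else One].
rewrite (reindex xi_of) /=; last first.
  exists (fun xi : {ffun T -> simple} => [set i | xi i == Aa]) => [S _|xi _].
    by apply/setP=> i; rewrite inE ffunE; case: (i \in S).
  by apply/ffunP=> i; rewrite ffunE inE; case: (xi i).
apply: eq_bigr => S _; congr G.
by apply/setP=> i; rewrite inE ffunE; case: (i \in S).
Qed.

Lemma sum_by_card (C : nmodType) (T : finType) (G : {set T} -> C) :
  \sum_(S : {set T}) G S =
  G set0 + \sum_(1 <= s < #|T|.+1) \sum_(S : {set T} | #|S| == s) G S.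
Proof.
rewrite (partition_big (fun S : {set T} => inord #|S| : 'I_(#|T|).+1) xpredT) //=.
transitivity (\sum_(s < #|T|.+1) \sum_(S : {set T} | #|S| == s) G S).
  apply: eq_bigr => s _; apply: eq_bigl => S.
  by rewrite -val_eqE /= inordK // ltnS max_card.
rewrite -(big_mkord xpredT (fun s => \sum_(S : {set T} | #|S| == s) G S)).
rewrite big_ltn //; congr (_ + _).
by rewrite (big_pred1 set0) // => S; rewrite cards_eq0.
Qed.

Theorem theorem8 (R : realType) (E : cat_data R)
    (Manifold : Type)
    (surgery : forall k : nat, seq (layer 'I_k) -> Manifold -> Prop)
    (tr : Manifold -> R[i])
    (tr_surgery : forall (k : nat) (L : seq (layer 'I_k)) (M : Manifold),
       link_diagram L -> surgery k L M -> tr M = tr_diagram E L)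
    (k : nat) (F : 'I_k -> int) (L : seq (layer 'I_k)) (Lpq : Manifold)
    (L_hopf : framed_hopf_diagram F L)
    (Lpq_surgery : surgery k L Lpq) :
  let e := (eps E)%:C in
  let sigma := signature (linking_matrix R L) in
  tr Lpq =
    (1 + e ^+ 2 * beta E ^+ 2) ^ sigma
      / (((eps E + 2) `^ ((sigma + k%:Z + 1)%:~R / 2))%:C)
    * (1 + \sum_(1 <= s < k.+1)
             e ^+ s * \sum_(S : {set 'I_k} | #|S| == s)
                        cfun E [seq val i | i <- enum S]
                          / beta E ^ (\sum_(i in S) 2 * F i)).
Proof.
move=> e sigma.
case: L_hopf => kinks [clasp [L_def framing]].
have diagL : link_diagram L by rewrite L_def; apply: link_diagram_hopf.
rewrite (tr_surgery k L Lpq diagL Lpq_surgery) /tr_diagram -/sigma -/(Delta E).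
rewrite -Dconst_powR -!opprD; congr (_ * _).
pose G (S : {set 'I_k}) := e ^+ #|S| *
  (cfun E [seq val i | i <- enum S] / beta E ^ (\sum_(i in S) 2 * F i)).
transitivity (\sum_(xi : {ffun 'I_k -> simple}) G [set i | xi i == Aa]).
  apply: eq_bigr => xi _; rewrite /G; congr (_ * _).
  rewrite L_def bracket_hopf; congr (_ / _ ^ _); apply: eq_bigr => i _.
  by rewrite -framing L_def self_writhe_hopf ?enum_uniq ?mem_enum.
rewrite sum_colourings sum_by_card card_ord /G cards0 enum_set0 big_set0 cfun_nil.
rewrite expr0 expr0z divr1 mulr1; congr (_ + _); apply: eq_bigr => s _.
by rewrite mulr_sumr; apply: eq_bigr => S /eqP->.
Qed.
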